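(* Let $k=k(n)\ge 0$ and $\ell=\ell(n)\ge 0$ be integers with $n\ell$ even, and define $a=kn^3/\ell$. Let $X$ be chosen uniformly at random from $\mathcal M(n,\ell)$, and let $X_{\min}$ be the least off-diagonal entry of $X$. Then, as $n\to\infty$, \[ \operatorname{Prob}(X_{\min}\ge k)\ \begin{cases}\to 0 & \text{if } a\to\infty,\\ \sim e^{-a/2} & \text{if } a=O(1).\end{cases} \]
   Context: $\mathcal M(n,\ell)$ denotes the set of $n\times n$ symmetric matrices with entries in $\{0,1,2,\dots\}$, all diagonal entries zero, and every row sum equal to $\ell$. *)

(* Defs.v *)
From mathcomp Require Import all_boot all_order all_algebra.
From mathcomp Require Import finmap.
From mathcomp Require Import all_classical all_reals all_analysis.
Set Implicit Arguments.
Unset Strict Implicit.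
Unset Printing Implicit Defensive.
Import Order.TTheory GRing.Theory Num.Theory.
Import numFieldNormedType.Exports.
Local Open Scope classical_set_scope.
Local Open Scope ring_scope.

Definition symmx (n l : nat) : set 'M[nat]_n :=
  [set X : 'M[nat]_n | [/\ X^T = X, forall i, X i i = 0%N
             & forall i, (\sum_(j < n) X i j)%N = l]].

Arguments symmx : clear implicits.

Lemma symmx_finite (n l : nat) : finite_set (symmx n l).
Proof.
pose f (Y : 'M['I_l.+1]_n) : 'M[nat]_n := map_mx (@nat_of_ord _) Y.
apply: (@sub_finite_set _ _ (range f)); last first.
  exact/finite_image/finite_finset.
move=> X [_ _ Xl]; exists (map_mx inord X) => //; apply/matrixP => i j.
by rewrite !mxE inordK // ltnS -(Xl i) (bigD1 j) //= leq_addr.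
Qed.

(* Only meaningful for [2 <= n]. The value over an empty range, the largest
   entry of [X], never affects the minimum when the range is nonempty. *)
Definition min_offdiag (n : nat) (X : 'M[nat]_n) : nat :=
  \big[minn/(\max_(p : 'I_n * 'I_n) X p.1 p.2)%N]_(p : 'I_n * 'I_n | p.1 != p.2)
    X p.1 p.2.

Lemma min_offdiag_geP (n : nat) (X : 'M[nat]_n) (k : nat) : (1 < n)%N ->
  (k <= min_offdiag X)%N <-> (forall i j, i != j -> (k <= X i j)%N).
Proof.
move=> n1; split=> [kX i j ij|kX].
  apply: leq_trans kX _; rewrite /min_offdiag -minEnat.
  exact: (@bigmin_le_cond _ _ _ _ (i, j)
    (fun p : 'I_n * 'I_n => p.1 != p.2) (fun p => X p.1 p.2)).
rewrite /min_offdiag; elim/big_ind: _ => [|x y kx ky|p /kX//].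
  pose i := Ordinal (ltnW n1); pose j := Ordinal n1.
  apply: leq_trans (kX i j _) _ => //.
  exact: (leq_bigmax (F := fun p : 'I_n * 'I_n => X p.1 p.2) (i, j)).
by rewrite leq_min kx.
Qed.

(* Probability of [A] for a uniform element of [S], which is meant to be finite
   and nonempty: [fset_set] is empty on an infinite set. *)
Definition unif_prob (R : realType) (T : choiceType) (S A : set T) : R :=
  #|` fset_set (S `&` A)|%:R / #|` fset_set S|%:R.

(* Main.v *)
(* Subtracting [k] from every off-diagonal entry shows that the probability is
   H(l - k(n-1)) / H(l), where H(l) is the number of matrices with row sum [l].
   Put the matrices P_s + P_s^T, for [s] a fixed-point-free permutation, in a
   fixed order. Every nonnegative symmetric real matrix with zero diagonal and
   constant row sums expands greedily along this list, with coefficients that are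
   uniquely determined (this is a pulling triangulation of the cone of such
   matrices). At most n(n-1)/2 coefficients are positive, and generically at least
   (n-2)(n-3)/2 are. Double counting these coefficients over all integer
   matrices, using that adding a generator shifts its coefficient by one, gives
     (l + 2 - n(n-1)) H(l+2) <= l H(l)   and
     (l + (n-2)(n-3)) H(l) <= (l+4) H(l+2),
   so that H(l) / H(l+2) is about 1 - n^2/l; iterating this about k(n-1)/2 times
   yields exp(- k n^3 / (2 l)). When [n] is even, monotonicity of H takes care of
   an odd k(n-1). *)

Require Import Defs.
From mathcomp Require Import all_boot all_order all_algebra.
From mathcomp Require Import perm finmap.
From mathcomp Require Import all_classical all_reals all_analysis.
From mathcomp Require Import zify ring lra.
Set Implicit Arguments.
Unset Strict Implicit.
Unset Printing Implicit Defensive.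
Import Order.TTheory GRing.Theory Num.Theory.
Import numFieldNormedType.Exports.
Local Open Scope ring_scope.

(** * Hall's theorem *)

(* Rado's argument: as long as some [A i] has two elements, one of them can be
   removed without destroying the Hall condition. *)
Lemma hall (I J : finType) (A : I -> {set J}) :
  (forall S : {set I}, #|S| <= #|\bigcup_(i in S) A i|)%N ->
  exists2 f : I -> J, injective f & forall i, f i \in A i.
Proof.
have [N leN] := ubnP (\sum_i #|A i|)%N.
elim: N => // N IHN in A leN *; move=> hallA.
have A1 i : (0 < #|A i|)%N.
  by have := hallA [set i]; rewrite cards1 big_set1.
case: (pickP (fun i => 1 < #|A i|)%N) => [i /card_gt1P [x [y [xi yi xy]]]|leA1].
  pose A' z j := if j == i then A i :\ z else A j.
  have A'E z (S : {set I}) : i \notin S ->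
      \bigcup_(j in S) A' z j = \bigcup_(j in S) A j.
    move=> iS; apply: eq_bigr => j jS; rewrite /A'.
    by case: eqP jS iS => // -> ->.
  have remove z : z \in A i ->
      (forall S : {set I}, #|S| <= #|\bigcup_(i in S) A' z i|)%N ->
      exists2 f : I -> J, injective f & forall i, f i \in A i.
    move=> zi /IHN [].
      rewrite -ltnS; apply: leq_trans leN; rewrite ltnS -addn1 (bigD1 i) //=.
      rewrite [X in (_ <= X)%N](bigD1 i) //= addnAC leq_add //.
        by rewrite /A' eqxx (cardsD1 z (A i)) zi addnC.
      by apply: leq_sum => j /negbTE ji; rewrite /A' ji.
    move=> f injf fA'; exists f => // j; have := fA' j; rewrite /A'.
    by case: eqP => // ->; rewrite inE => /andP[].
  have bad z : z \in A i ->
      (exists2 f : I -> J, injective f & forall i, f i \in A i) \/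
      exists2 S : {set I}, i \in S & (#|\bigcup_(i in S) A' z i| < #|S|)%N.
    move=> zi; case: (pickP (fun S : {set I} =>
      #|\bigcup_(i in S) A' z i| < #|S|)%N) => [S Slt|nbad].
      right; exists S => //; case: (boolP (i \in S)) => // iS.
      by move: Slt; rewrite A'E // ltnNge hallA.
    by left; apply: (remove z) => // S; rewrite leqNgt nbad.
  have [//|[S iS Slt]] := bad x xi; have [//|[T iT Tlt]] := bad y yi.
  (* Submodularity: |X| + |Y| is at most |S| + |T| - 2, whereas Hall's condition on [S :|: T] and on
     [(S :&: T) :\ i] forces at least |S| + |T| - 1. *)
  set X := \bigcup_(i in S) _ in Slt; set Y := \bigcup_(i in T) _ in Tlt.
  have XUY : \bigcup_(j in S :|: T) A j \subset X :|: Y.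
    apply/bigcupsP => j jST; apply/fintype.subsetP => z zj.
    have [ji|ji] := eqVneq j i.
      have [zx|zx] := eqVneq z x.
        apply/setUP; right; apply/bigcupP; exists i => //.
        by rewrite /A' eqxx !inE zx xy -zx -ji.
      apply/setUP; left; apply/bigcupP; exists i => //.
      by rewrite /A' eqxx !inE zx -ji.
    have [jS|jT] := setUP jST; apply/setUP; [left|right];
      by apply/bigcupP; exists j => //; rewrite /A' (negbTE ji).
  have XIY : \bigcup_(j in (S :&: T) :\ i) A j \subset X :&: Y.
    apply/bigcupsP => j /setD1P[ji /setIP[jS jT]].
    by rewrite finset.subsetI; apply/andP; split;
      apply: (bigcup_max j) => //; rewrite /A' (negbTE ji).
  have := leq_trans (hallA _) (subset_leq_card XUY).
  have := leq_trans (hallA _) (subset_leq_card XIY).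
  have := cardsD1 i (S :&: T); rewrite inE iS iT /=.
  have := cardsUI S T; have := cardsUI X Y; lia.
have A1P i : exists x, A i == [set x].
  have /cards1P[x ->] : #|A i| == 1%N by rewrite eqn_leq A1 andbT leqNgt leA1.
  by exists x.
pose f i := xchoose (A1P i).
have fE i : A i = [set f i] by apply/eqP/(xchooseP (A1P i)).
exists f => [i j fij|i]; last by rewrite fE set11.
apply/eqP/negPn/negP => ij; have := hallA [set i; j].
by rewrite finset.bigcup_setU !big_set1 !fE fij finset.setUid cards1 cards2 ij.
Qed.

(** * Greedy expansions *)

Definition regmx (R : numDomainType) (n : nat) (r : R) (x : 'M[R]_n) : Prop :=
  [/\ forall p q, 0 <= x p q, forall p q, x p q = x q p,
      forall p, x p p = 0 & forall p, \sum_q x p q = r].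

(** For a fixed-point-free [s], the adjacency matrix of the 2-regular multigraph formed by the
    cycles of [s]; a 2-cycle is a double edge. *)
Definition cover2 (n : nat) (s : 'S_n) : 'M[nat]_n :=
  \matrix_(p, q) ((s p == q) + (s q == p))%N.

Lemma cover2_symmx (n : nat) (s : 'S_n) :
  (forall p, s p != p) -> symmx n 2 (cover2 s).
Proof.
move=> sN; split=> [|p|p]; first by apply/matrixP => p q; rewrite !mxE addnC.
  by rewrite mxE (negbTE (sN p)).
have sum1 q : (\sum_(p < n) (p == q) = 1)%N.
  by rewrite (bigD1 q) //= eqxx big1 // => i /negbTE ->.
under eq_bigr do rewrite mxE.
rewrite big_split /=.
under eq_bigr do rewrite eq_sym.
rewrite sum1; congr addn.
by rewrite -(sum1 p) [RHS](reindex_inj (@perm_inj _ s)).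
Qed.

(* The bipartite double cover of the support of [x] satisfies Hall's condition. *)
Lemma regmx_cover2 (R : realFieldType) (n : nat) (r : R) (x : 'M[R]_n) :
  regmx r x -> 0 < r ->
  exists2 s : 'S_n, (forall p, s p != p) &
    forall p q, (0 < cover2 s p q)%N -> 0 < x p q.
Proof.
move=> [x0 xT xd xr] r0.
have [|f injf xf] := @hall _ _ (fun p => finset (fun q => 0 < x p q)).
  move=> S; set N := \bigcup_(_ in _) _.
  rewrite -(ler_nat R) -(ler_pM2r r0).
  (* The rows in [S] have total mass [r] times #|S|, all of it inside the columns [N], whose total
     mass is [r] times #|N|. *)
  have -> : #|S|%:R * r = \sum_(p in S) \sum_q x p q.
    by under eq_bigr do rewrite xr; rewrite sumr_const mulr_natl.
  have -> : #|N|%:R * r = \sum_(q in N) \sum_p x p q.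
    under eq_bigr do under eq_bigr do rewrite xT.
    by under eq_bigr do rewrite xr; rewrite sumr_const mulr_natl.
  rewrite exchange_big /= [leRHS]big_mkcond; apply: ler_sum => q _.
  case: ifP => [_|/negbT qN].
    rewrite [leRHS](bigID (mem S)) /= lerDl; exact: sumr_ge0.
  rewrite le_eqVlt big1 ?eqxx // => p pS; apply/eqP; rewrite eq_le x0 andbT.
  rewrite leNgt; apply: contra qN => xpq.
  by apply/bigcupP; exists p => //; rewrite inE.
have {}xf p : 0 < x p (f p) by have := xf p; rewrite inE.
exists (perm injf) => [p|p q].
  by rewrite permE; apply: contraTneq (xf p) => ->; rewrite xd ltxx.
rewrite mxE !permE addn_gt0 !lt0b => /orP[/eqP <-|/eqP <-] //.
by rewrite xT.
Qed.

(* The generators come in a fixed order, which drives the greedy expansion. *)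
Definition spanning (R : numDomainType) (n m : nat) (v : 'I_m -> 'M[nat]_n) :=
  (forall i, symmx n 2 (v i)) /\
  forall (r : R) x, regmx r x -> 0 < r ->
    exists i, forall p q, (0 < v i p q)%N -> 0 < x p q.

Lemma spanning_exists (R : realFieldType) (n : nat) :
  exists m, exists v : 'I_m -> 'M[nat]_n, spanning R v.
Proof.
pose A := finset (fun s : 'S_n => [forall p, s p != p]).
exists #|A|; exists (fun i => cover2 (enum_val i)); split.
  by move=> i; have := enum_valP i; rewrite inE => /forallP /cover2_symmx.
move=> r x xr /(regmx_cover2 xr)[s sN sx].
have sA : s \in A by rewrite inE; apply/forallP.
by exists (enum_rank_in sA s); rewrite enum_rankK_in.
Qed.

(* [c] is the vector of coefficients obtained from [x] by subtracting the
   largest possible multiple of each generator in turn: at each stage, some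
   entry of [v i] has nothing left for the later generators. *)
Definition greedy (R : numDomainType) (n m : nat) (v : 'I_m -> 'M[nat]_n)
    (c : 'I_m -> R) (x : 'M[R]_n) : Prop :=
  [/\ forall i, 0 <= c i,
      forall i, exists p, exists2 q, (0 < v i p q)%N &
        forall j : 'I_m, (i < j)%N -> 0 < c j -> v j p q = 0%N
    & forall p q, x p q = \sum_i c i * (v i p q)%:R].

(** Induction along the order: if all earlier coefficients agree, then at the blocking entry of [i]
    for one expansion no later generator contributes to it, so its [i]-th coefficient is at least
    that of the other. Exchange the roles for equality. *)
Lemma greedy_uniq (R : realDomainType) (n m : nat) (v : 'I_m -> 'M[nat]_n)
    (c d : 'I_m -> R) (x : 'M[R]_n) :
  greedy v c x -> greedy v d x -> c =1 d.
Proof.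
move=> cx dx i; have [k ik] := ubnP i; elim: k => // k IHk in i ik *.
have {}IHk (j : 'I_m) : (j < i)%N -> c j = d j.
  by move=> ji; apply: IHk; apply: leq_trans ji _.
have half (a b : 'I_m -> R) : greedy v a x -> greedy v b x ->
    (forall j : 'I_m, (j < i)%N -> a j = b j) -> b i <= a i.
  move=> [a0 ai ax] [b0 _ bx] ab; have [p [q vi later]] := ai i.
  have := ax p q; rewrite bx (bigD1 i) //= [RHS](bigD1 i) //=.
  rewrite !(bigID (fun j : 'I_m => j < i)%N (fun j => j != i)) /=.
  have -> : \sum_(j < m | (j != i) && (j < i)%N) a j * (v j p q)%:R =
            \sum_(j < m | (j != i) && (j < i)%N) b j * (v j p q)%:R.
    by apply: eq_bigr => j /andP[_ /ab ->].
  have -> : \sum_(j < m | (j != i) && ~~ (j < i)%N) a j * (v j p q)%:R = 0.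
    apply: big1 => j /andP[ji ij]; have := a0 j.
    rewrite le_eqVlt => /orP[/eqP <-|aj]; first by rewrite mul0r.
    by rewrite later ?mulr0 // ltn_neqAle eq_sym ji leqNgt.
  have : 0 <= \sum_(j < m | (j != i) && ~~ (j < i)%N) b j * (v j p q)%:R.
    by apply: sumr_ge0 => j _; rewrite mulr_ge0.
  set s := \sum_(_ < _ | _) _; set t := \sum_(_ < _ | _) _ => t0 /eqP.
  rewrite addr0 addrCA [eqbRHS]addrC (inj_eq (addrI _)) => /eqP e.
  have vi0 : 0 < (v i p q)%:R :> R by rewrite ltr0n.
  by rewrite -(ler_pM2r vi0) -e lerDl.
by apply/eqP; rewrite eq_le !half // => j /IHk.
Qed.

(** Blocking depends only on which coefficients are positive, so it survives any change that does
    not enlarge the support. With uniqueness, this computes the coefficients after one generator is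
    added or removed. *)
Lemma greedy_sub (R : realDomainType) (n m : nat) (v : 'I_m -> 'M[nat]_n)
    (c d : 'I_m -> R) (x y : 'M[R]_n) :
  greedy v c x -> (forall i, 0 <= d i) -> (forall i, 0 < d i -> 0 < c i) ->
  (forall p q, y p q = \sum_i d i * (v i p q)%:R) -> greedy v d y.
Proof.
move=> [c0 cs cx] d0 dc yE; split=> // i; have [p [q vi later]] := cs i.
by exists p; exists q => // j ij /dc; apply: later.
Qed.

Lemma greedy_sum (R : realDomainType) (n m : nat) (v : 'I_m -> 'M[nat]_n)
    (c : 'I_m -> R) (x : 'M[R]_n) (r : R) :
  (0 < n)%N -> (forall i, symmx n 2 (v i)) -> regmx r x -> greedy v c x ->
  (\sum_i c i) * 2 = r.
Proof.
move=> n0 vP [_ _ _ xr] [_ _ cx].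
rewrite -(xr (Ordinal n0)); under [RHS]eq_bigr do rewrite cx.
rewrite exchange_big /= mulr_suml; apply: eq_bigr => i _.
have [_ _ /(_ (Ordinal n0)) vi] := vP i.
by rewrite -mulr_sumr -natr_sum vi.
Qed.

Lemma card_ltn_pairs (n : nat) :
  #|finset (fun e : 'I_n * 'I_n => e.1 < e.2)%N| = 'C(n, 2).
Proof.
rewrite -sum1_card -bin2_sum big_mkord.
transitivity (\sum_(q < n) \sum_(p < n | (p < q)%N) 1)%N.
  rewrite (exchange_big_dep xpredT) //= pair_big_dep; apply: eq_bigl => e.
  by rewrite inE.
apply: eq_bigr => q _.
rewrite -(big_ord_widen _ (fun _ => 1%N) (ltnW (ltn_ord q))).
by rewrite sum_nat_const card_ord muln1.
Qed.

(** Send each generator to its blocking entry, taken above the diagonal by symmetry. Two generators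
    with positive coefficients cannot share it: the later one would have to vanish there, yet it is
    positive at its own blocking entry. *)
Lemma greedy_card (R : realDomainType) (n m : nat) (v : 'I_m -> 'M[nat]_n)
    (c : 'I_m -> R) (x : 'M[R]_n) :
  (forall i, symmx n 2 (v i)) -> greedy v c x ->
  (#|finset (fun i => 0 < c i)%R| <= 'C(n, 2))%N.
Proof.
move=> vP [_ cs _].
have pick i : exists e : 'I_n * 'I_n, [&& (e.1 < e.2)%N, (0 < v i e.1 e.2)%N &
    [forall j : 'I_m, (i < j)%N ==> (0 < c j) ==> (v j e.1 e.2 == 0%N)]].
  have [p [q vi later]] := cs i; have [vT vd _] := vP i.
  case: (ltngtP p q) => [pq|qp|/val_inj pq].
  - exists (p, q); rewrite pq vi; apply/forallP => j.
    by apply/implyP => ij; apply/implyP => cj; rewrite later.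
  - exists (q, p); rewrite qp -{1}vT mxE vi; apply/forallP => j.
    apply/implyP => ij; apply/implyP => cj; have [vjT _ _] := vP j.
    by rewrite -vjT mxE later.
  - by move: vi; rewrite pq vd.
pose f i := xchoose (pick i).
have fP i : [&& ((f i).1 < (f i).2)%N, (0 < v i (f i).1 (f i).2)%N &
    [forall j : 'I_m, (i < j)%N ==> (0 < c j) ==> (v j (f i).1 (f i).2 == 0%N)]].
  exact: (xchooseP (pick i)).
rewrite -card_ltn_pairs -(card_in_imset (f := f)).
  apply: subset_leq_card; apply/fintype.subsetP => _ /imsetP[i _ ->].
  by rewrite inE; have /andP[] := fP i.
have asym (i j : 'I_m) : 0 < c j -> f i = f j -> ~~ (i < j)%N.
  move=> cj fij; apply/negP => ij; have /and3P[_ _ /forallP/(_ j)] := fP i.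
  by rewrite ij cj fij; have /and3P[_ vj _] := fP j; rewrite -leqn0 leqNgt vj.
move=> i j; rewrite !inE => ci cj fij; apply: val_inj.
by case: (ltngtP i j) => // ij; [have := asym i j cj fij|
  have := asym j i ci (esym fij)]; rewrite ij.
Qed.

Lemma symmx2_gt0 (n : nat) (v : 'M[nat]_n) :
  (0 < n)%N -> symmx n 2 v -> exists p, exists q, (0 < v p q)%N.
Proof.
move=> n0 [_ _ /(_ (Ordinal n0)) vr]; exists (Ordinal n0).
case: (pickP (fun q => 0 < v (Ordinal n0) q)%N) => [q vq|v0]; first by exists q.
by move: vr; rewrite big1 // => q _; apply/eqP; rewrite -leqn0 leqNgt v0.
Qed.

Lemma regmxB (R : numDomainType) (n : nat) (v : 'M[nat]_n) (r t : R)
    (x : 'M[R]_n) :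
  symmx n 2 v -> regmx r x -> (forall p q, t * (v p q)%:R <= x p q) ->
  regmx (r - t * 2) (\matrix_(p, q) (x p q - t * (v p q)%:R)).
Proof.
move=> [vT vd vr] [_ xT xd xr] tx; split=> [p q|p q|p|p].
- by rewrite mxE subr_ge0.
- by rewrite !mxE xT -{1}vT mxE.
- by rewrite mxE xd vd mulr0 subr0.
- under eq_bigr do rewrite mxE.
  by rewrite sumrB xr -mulr_sumr -natr_sum vr.
Qed.

(** Treat the generators in order, keeping a nonnegative residual [y]. Each step subtracts the
    largest admissible multiple [t], which makes [y] vanish at some entry of the current generator;
    that entry blocks it from then on. *)
Lemma greedy_exists (R : realFieldType) (n m : nat) (v : 'I_m -> 'M[nat]_n)
    (r : R) (x : 'M[R]_n) :
  (0 < n)%N -> spanning R v -> regmx r x -> exists c, greedy v c x.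
Proof.
move=> n0 [vP vspan] xr.
have /(_ m (leqnn m)) : forall k, (k <= m)%N -> exists c : 'I_m -> R,
    exists y, exists s, [/\ regmx s y, forall i, 0 <= c i,
      forall i : 'I_m, (k <= i)%N -> c i = 0,
      forall p q, x p q = \sum_i c i * (v i p q)%:R + y p q &
      forall i : 'I_m, (i < k)%N -> exists p, exists q,
        [/\ (0 < v i p q)%N, y p q = 0 &
          forall j : 'I_m, (i < j)%N -> 0 < c j -> v j p q = 0%N]].
  elim=> [_|k IHk km].
    exists (fun=> 0), x, r; split=> // p q.
    by rewrite big1 ?add0r // => i _; rewrite mul0r.
  have [c [y [s [yr c0 ck xE cs]]]] := IHk (ltnW km).
  have [y0 _ _ _] := yr.
  pose i0 := Ordinal km; have [p0 [q0 v0]] := symmx2_gt0 n0 (vP i0).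
  pose F (e : 'I_n * 'I_n) := y e.1 e.2 / (v i0 e.1 e.2)%:R.
  have [[p q] /= vpq tmin] := @Order.TotalTheory.arg_minP _ _ _ (p0, q0)
    (fun e : 'I_n * 'I_n => 0 < v i0 e.1 e.2)%N F v0.
  have vpqR : 0 < (v i0 p q)%:R :> R by rewrite ltr0n.
  pose t := y p q / (v i0 p q)%:R.
  have t0 : 0 <= t by rewrite divr_ge0 // ltW.
  have ty p' q' : t * (v i0 p' q')%:R <= y p' q'.
    have [->|v'] := posnP (v i0 p' q'); first by rewrite mulr0.
    by rewrite -ler_pdivlMr ?ltr0n //; apply: (tmin (p', q')).
  exists (fun i => if i == i0 then t else c i).
  exists (\matrix_(p, q) (y p q - t * (v i0 p q)%:R)), (s - t * 2); split.
  - exact: regmxB.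
  - by move=> i; case: ifP.
  - move=> i ki; case: eqP => [ii0|_]; first by move: ki; rewrite ii0 ltnn.
    by apply: ck; apply: ltnW.
  - move=> p' q'; rewrite xE mxE (bigD1 i0) //= [in RHS](bigD1 i0) //= eqxx.
    rewrite ck //= mul0r add0r addrCA addrAC subrr add0r addrC; congr (_ + _).
      by apply: eq_bigr => i /negbTE ->.
  - move=> i; rewrite ltnS leq_eqVlt => /orP[/eqP ik|ik].
      have -> : i = i0 by apply: val_inj.
      exists p, q; split=> //.
        by rewrite mxE /t divfK ?subrr // gt_eqF.
      move=> j ij; case: eqP ij => [->|_ ij]; first by rewrite ltnn.
      by rewrite ck ?ltxx // ltnW.
    have [p' [q' [vi yi later]]] := cs i ik; exists p', q'.
    have := ty p' q'; rewrite yi => ty0.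
    (* The residual is already zero at a previously blocked entry, so a positive [t] forces [v i0]
       to vanish there. *)
    have tv : t * (v i0 p' q')%:R = 0.
      by apply/eqP; rewrite eq_le ty0 mulr_ge0.
    split=> //; first by rewrite mxE yi tv subrr.
    move=> j ij; case: eqP => [->|_]; last exact: later.
    move=> tp; apply/eqP; rewrite -(pnatr_eq0 R).
    by move/eqP: tv; rewrite mulf_eq0 gt_eqF.
move=> [c [y [s [yr c0 _ xE cs]]]]; exists c.
have [y0 yT yd ys] := yr.
(* A residual of positive row sum would contain some generator in its support, but every generator
   is blocked by a zero of [y]. *)
have s0 : s = 0.
  apply/eqP; rewrite eq_le -{2}(ys (Ordinal n0)) sumr_ge0 // andbT leNgt.
  apply/negP => /(vspan _ _ yr)[i vy].
  have [p [q [vi yi _]]] := cs i (ltn_ord i).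
  by have := vy p q vi; rewrite yi ltxx.
split=> // [i|p q].
  by have [p [q [vi _ later]]] := cs i (ltn_ord i); exists p, q.
rewrite xE [y p q](_ : _ = 0) ?addr0 //; apply/eqP; rewrite eq_le y0 andbT.
by rewrite -s0 -(ys p) (bigD1 q) //= lerDl sumr_ge0.
Qed.

(** * Growth of the number of matrices *)

Definition nsymmx (n l : nat) : nat := #|` fset_set (symmx n l)|.

Definition natmx (R : numDomainType) (n : nat) (X : 'M[nat]_n) : 'M[R]_n :=
  map_mx (fun k => k%:R) X.

Lemma in_symmx (n l : nat) (X : 'M[nat]_n) :
  X \in fset_set (symmx n l) <-> symmx n l X.
Proof.
rewrite (in_fset_set (symmx_finite n l)).
by split=> [/set_mem//|/mem_set].
Qed.

Lemma natmx_regmx (R : numDomainType) (n l : nat) (X : 'M[nat]_n) :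
  symmx n l X -> regmx l%:R (natmx R X).
Proof.
move=> [XT Xd Xr]; split=> [p q|p q|p|p]; rewrite ?mxE //.
- by rewrite -{1}XT mxE.
- by rewrite Xd.
- by under eq_bigr do rewrite mxE; rewrite -natr_sum Xr.
Qed.

Lemma regmxD (R : numDomainType) (n : nat) (r s : R) (x y : 'M[R]_n) :
  regmx r x -> regmx s y -> regmx (r + s) (x + y).
Proof.
move=> [x0 xT xd xr] [y0 yT yd yr]; split=> [p q|p q|p|p]; rewrite ?mxE.
- exact: addr_ge0.
- by rewrite xT yT.
- by rewrite xd yd addr0.
- by under eq_bigr do rewrite mxE; rewrite big_split /= xr yr.
Qed.

Lemma symmxD (n l l' : nat) (X Y : 'M[nat]_n) :
  symmx n l X -> symmx n l' Y -> symmx n (l + l') (X + Y).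
Proof.
move=> [XT Xd Xr] [YT Yd Yr]; split=> [|p|p].
- by rewrite linearD /= XT YT.
- by rewrite mxE Xd Yd.
- by under eq_bigr do rewrite mxE; rewrite big_split /= Xr Yr.
Qed.

Lemma symmxB (n l l' : nat) (X Y : 'M[nat]_n) :
  symmx n l X -> symmx n l' Y -> (forall p q, (Y p q <= X p q)%N) ->
  symmx n (l - l') (\matrix_(p, q) (X p q - Y p q)%N).
Proof.
move=> [XT Xd Xr] [YT Yd Yr] YX; split=> [|p|p].
- by apply/matrixP => p q; rewrite !mxE -{1}XT -{1}YT !mxE.
- by rewrite mxE Xd.
- rewrite -(Xr p) -(Yr p) -sumnB; last by move=> q _; apply: YX.
  by apply: eq_bigr => q _; rewrite mxE.
Qed.

(** The injection hits each element of [B] at most once, and the elements missed contribute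
    nonnegatively. This is the double counting step of both growth estimates. *)
Lemma ler_sum_inj (R : numDomainType) (T U : eqType) (A : seq T) (B : seq U)
    (P : pred T) (g : T -> U) (F : U -> R) :
  uniq A -> uniq B -> {in [pred x in A | P x] &, injective g} ->
  (forall x, x \in A -> P x -> g x \in B) -> (forall y, y \in B -> 0 <= F y) ->
  \sum_(x <- A | P x) F (g x) <= \sum_(y <- B) F y.
Proof.
move=> uA uB injg gB F0.
rewrite [leRHS](bigID (fun y => y \in [seq g x | x <- A & P x])) /=.
rewrite -[leLHS]addr0 lerD //; last first.
  by rewrite big_seq_cond sumr_ge0 // => y /andP[/F0].
rewrite -big_filter -(big_map g predT) -[leRHS]big_filter.
rewrite le_eqVlt; apply/orP; left; apply/eqP/perm_big.
apply: uniq_perm.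
- rewrite map_inj_in_uniq ?filter_uniq // => x y.
  by rewrite !mem_filter => /andP[Px xA] /andP[Py yA]; apply: injg; apply/andP.
- exact: filter_uniq.
- move=> y; rewrite mem_filter; case: mapP => //= -[x].
  by rewrite mem_filter => /andP[Px xA] ->; rewrite gB.
Qed.

(* Peeling one copy of [v i] off every [Y] with [i]-th coefficient [>= 1] maps
   into the row-sum-[l] matrices and lowers that coefficient by one; there are at
   most ['C(n, 2)] positive coefficients, so little is lost. *)
Lemma nsymmx_growth_le (R : realFieldType) (n l : nat) : (0 < n)%N ->
  ((l + 2)%:R - (n * n.-1)%:R) * (nsymmx n (l + 2))%:R <=
    l%:R * (nsymmx n l)%:R :> R.
Proof.
move=> n0; have [m [v vspan]] := spanning_exists R n; have [vP _] := vspan.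
(* The choice of [c] ignores the row sum, so one function serves both [l] and [l + 2]. *)
have /choice[c cP] : forall X : 'M[nat]_n, exists c : 'I_m -> R,
    forall k, symmx n k X -> greedy v c (natmx R X).
  move=> X; have [[k Xk]|nX] := pselect (exists k, symmx n k X).
    have [c cX] := greedy_exists n0 vspan (natmx_regmx R Xk).
    by exists c.
  by exists (fun=> 0) => k Xk; case: nX; exists k.
pose g i (Y : 'M[nat]_n) : 'M[nat]_n := \matrix_(p, q) (Y p q - v i p q)%N.
have c0 X k i : symmx n k X -> 0 <= c X i by move=> /cP [].
have vY Y i : symmx n (l + 2) Y -> 1 <= c Y i ->
    forall p q, (v i p q <= Y p q)%N.
  move=> Yl c1 p q; have [_ _ /(_ p q)] := cP _ _ Yl.
  rewrite mxE (bigD1 i) //= => YE; rewrite -(ler_nat R) YE.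
  rewrite -[leLHS]addr0 lerD ?ler_peMl //.
  by apply: sumr_ge0 => j _; rewrite mulr_ge0 // (c0 _ _ _ Yl).
have cg Y i : symmx n (l + 2) Y -> 1 <= c Y i ->
    symmx n l (g i Y) /\ c (g i Y) i = c Y i - 1.
  move=> Yl c1; have gY : symmx n l (g i Y).
    by rewrite -[l](addnK 2%N); apply: symmxB => //; apply: vY.
  split=> //; pose d j := c Y j - (j == i)%:R.
  rewrite (@greedy_uniq _ _ _ _ (c (g i Y)) d _ (cP _ _ gY)).
    by rewrite /d eqxx.
  apply: greedy_sub (cP _ _ Yl) _ _ _ => [j|j|p q].
  - by rewrite /d; case: eqP => [->|_]; rewrite ?subr_ge0 ?subr0 ?(c0 _ _ _ Yl).
  - by rewrite /d subr_gt0; apply: le_lt_trans.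
  - have [_ _ /(_ p q)] := cP _ _ Yl; rewrite !mxE => YE.
    rewrite natrB ?vY // YE /d; under [RHS]eq_bigr do rewrite mulrBl.
    rewrite sumrB; congr (_ - _); rewrite (bigD1 i) //= eqxx mul1r big1 ?addr0 //.
    by move=> j /negbTE ->; rewrite mul0r.
have lower Y : symmx n (l + 2) Y ->
    (l + 2)%:R - (n * n.-1)%:R <= 2 * \sum_(i | 1 <= c Y i) (c Y i - 1).
  move=> Yl; rewrite -(greedy_sum n0 vP (natmx_regmx R Yl) (cP _ _ Yl)).
  have card_c := greedy_card vP (cP _ _ Yl).
  have -> : (n * n.-1)%:R = 2 * 'C(n, 2)%:R :> R.
    by rewrite -natrM -(mul_bin_diag n 1) bin1.
  rewrite mulrC -mulrBr ler_pM2l //.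
  (* Only the positive coefficients, at most ['C(n, 2)] of them, are lowered by one; those below one
     then give negative terms, which are dropped. *)
  apply: (@le_trans _ _ (\sum_(i | 0 < c Y i) (c Y i - 1))).
    rewrite sumrB [X in X - _ <= _](bigID (fun i => 0 < c Y i)) /=.
    rewrite [X in _ + X - _]big1 ?addr0 => [|i]; last first.
      by rewrite -leNgt => ci; apply/eqP; rewrite eq_le ci (c0 _ _ _ Yl).
    rewrite lerD2l lerN2 sumr_const ler_nat.
    by apply: leq_trans card_c; apply: subset_leq_card; apply/fintype.subsetP => i;
       rewrite inE.
  rewrite (bigID (fun i => 1 <= c Y i)) /= -[leRHS]addr0 lerD //.
    rewrite le_eqVlt; apply/orP; left; apply/eqP; apply: eq_bigl => i.
    by case: (leP 1 (c Y i)) => c1; rewrite ?andbF // andbT (lt_le_trans ltr01).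
  by apply: sumr_le0 => i /andP[_]; rewrite -ltNge subr_le0 => /ltW.
have -> : ((l + 2)%:R - (n * n.-1)%:R) * (nsymmx n (l + 2))%:R =
  \sum_(Y <- fset_set (symmx n (l + 2))) ((l + 2)%:R - (n * n.-1)%:R) :> R.
  by rewrite big_const_seq count_predT iter_addr_0 mulr_natr.
have -> : l%:R * (nsymmx n l)%:R =
    2 * \sum_(X <- fset_set (symmx n l)) \sum_i c X i :> R.
  rewrite big_seq mulr_sumr.
  under eq_bigr => X /in_symmx Xl.
    rewrite mulrC (greedy_sum n0 vP (natmx_regmx R Xl) (cP _ _ Xl)); over.
  by rewrite -big_seq big_const_seq count_predT iter_addr_0 mulr_natr.
apply: (@le_trans _ _ (\sum_(Y <- fset_set (symmx n (l + 2)))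
    2 * \sum_(i | 1 <= c Y i) (c Y i - 1))).
  by rewrite big_seq [leRHS]big_seq; apply: ler_sum => Y /in_symmx /lower.
rewrite -mulr_sumr ler_pM2l // (exchange_big_dep xpredT) //= [leRHS]exchange_big.
apply: ler_sum => i _ /=.
apply: (@le_trans _ _ (\sum_(Y <- fset_set (symmx n (l + 2)) | 1 <= c Y i)
    c (g i Y) i)).
  rewrite big_seq_cond [leRHS]big_seq_cond; apply: ler_sum => Y.
  by move=> /andP[/in_symmx Yl /(cg _ _ Yl)[_ ->]].
apply: (@ler_sum_inj _ _ _ _ _ (fun Y => 1 <= c Y i) (g i) (fun X => c X i)) => //;
  try exact: fset_uniq.
- move=> Y Z /andP[/= /in_symmx Yl cY] /andP[/= /in_symmx Zl cZ] /matrixP gYZ.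
  apply/matrixP => p q; have := gYZ p q; rewrite !mxE.
  by have := vY _ _ Yl cY p q; have := vY _ _ Zl cZ p q; lia.
- by move=> Y /in_symmx Yl /(cg _ _ Yl)[gl _]; apply/in_symmx.
- by move=> X /in_symmx /c0.
Qed.

(** * Generic perturbations *)

(** The numbers [s0 / k.+1] with [k < size Q] are distinct and outnumber the possible roots of
    [Q]. *)
Lemma avoid_root (R : realFieldType) (Q : {poly R}) (s0 : R) :
  Q != 0 -> 0 < s0 -> exists s, [/\ 0 < s, s <= s0 & ~~ root Q s].
Proof.
move=> Q0 s0P; pose f k : R := s0 / k.+1%:R.
case: (pickP (fun k : 'I_(size Q) => ~~ root Q (f k))) => [k kQ|allQ].
  exists (f k); split=> //; first by rewrite divr_gt0.
  by rewrite ler_pdivrMr // ler_peMr ?(ltW s0P) // ler1n.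
have := @max_poly_roots _ Q [seq f (val k) | k <- enum 'I_(size Q)] Q0.
rewrite size_map -cardE card_ord ltnn => too_many; suff: false by [].
apply: too_many.
  by apply/allP => _ /mapP[k _ ->]; have /negbFE := allQ k.
rewrite map_inj_uniq ?enum_uniq // => i j /(mulfI (lt0r_neq0 s0P)) /invr_inj.
by move/eqP; rewrite eqr_nat eqSS => /eqP/val_inj.
Qed.

(** Fewer than [D] vectors are killed by a nonzero linear form [f]. Applying [f] to the curve gives
    a polynomial in [s] whose coefficient of degree [k.+1] is [f 0 k], so it is nonzero, and it
    vanishes whenever the curve meets the span. *)
Lemma span_root (R : fieldType) (D m : nat) (y : 'I_D -> R)
    (v : 'I_m -> 'I_D -> R) (S : {set 'I_m}) : (#|S| < D)%N ->
  exists2 Q : {poly R}, Q != 0 &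
    forall s c, (forall k : 'I_D, y k + s ^+ k.+1 = \sum_(i in S) c i * v i k) ->
      root Q s.
Proof.
move=> SD; pose A : 'M[R]_(D, #|S|) := \matrix_(k, i) v (enum_val i) k.
have kerA : kermx A != 0.
  rewrite -mxrank_eq0 mxrank_ker -lt0n subn_gt0.
  exact: leq_ltn_trans (rank_leq_col A) SD.
have /rowV0Pn[f fker f0] := kerA.
have fA : f *m A = 0 by apply/eqP; rewrite -sub_kermx.
have fv i : i \in S -> \sum_k f 0 k * v i k = 0.
  move=> iS; have /matrixP/(_ 0 (enum_rank_in iS i)) := fA.
  rewrite [RHS]mxE mxE => fAi; rewrite -[RHS]fAi; apply: eq_bigr => k _.
  by rewrite mxE enum_rankK_in.
pose Q : {poly R} := (\sum_k f 0 k * y k)%:P + \sum_(k < D) f 0 k *: 'X^(k.+1).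
exists Q => [|s c ys].
  have /rV0Pn[k fk] := f0.
  apply: contraNneq fk => /(congr1 (fun P : {poly R} => P`_k.+1)).
  rewrite coefD coefC /= add0r coef_sum coef0 => <-.
  rewrite (bigD1 k) //= coefZ coefXn eqxx mulr1 big1 ?addr0 // => j jk.
  rewrite coefZ coefXn eqSS; case: eqP => [/val_inj kj|]; last by rewrite mulr0.
  by rewrite kj eqxx in jk.
rewrite /root hornerD hornerC horner_sum -big_split /=.
under eq_bigr do rewrite hornerZ hornerXn -mulrDr ys mulr_sumr.
rewrite exchange_big big1 // => i iS /=.
under eq_bigr do rewrite mulrCA.
by rewrite -mulr_sumr fv ?mulr0.
Qed.

Definition edge (R : pzSemiRingType) (n : nat) (a b : 'I_n) : 'M[R]_n :=
  \matrix_(p, q) (((p == a) && (q == b))%:R + ((p == b) && (q == a))%:R).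

Lemma edge_sum (R : pzSemiRingType) (n : nat) (a b p : 'I_n) :
  \sum_q edge R a b p q = (p == a)%:R + (p == b)%:R.
Proof.
under eq_bigr do rewrite mxE.
have sum1 (x : 'I_n) (t : bool) : \sum_(q < n) (t && (q == x))%:R = t%:R :> R.
  by rewrite (bigD1 x) //= eqxx andbT big1 ?addr0 // => q /negbTE ->; rewrite andbF.
by rewrite big_split /= !sum1.
Qed.

(** Signs alternate around the cycle [a b c d], so adding a multiple leaves all row sums
    unchanged. *)
Definition cycle4 (R : comNzRingType) (n : nat) (a b c d : 'I_n) : 'M[R]_n :=
  edge R a b - edge R b c + edge R c d - edge R d a.

Lemma cycle4_sum (R : comNzRingType) (n : nat) (a b c d p : 'I_n) :
  \sum_q cycle4 R a b c d p q = 0.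
Proof.
have cycle4E q : cycle4 R a b c d p q =
    edge R a b p q - edge R b c p q + edge R c d p q - edge R d a p q.
  by rewrite !mxE.
under eq_bigr do rewrite cycle4E.
by rewrite sumrB big_split sumrB /= !edge_sum; ring.
Qed.

Lemma edge_sym (R : pzSemiRingType) (n : nat) (a b p q : 'I_n) :
  edge R a b p q = edge R a b q p.
Proof. by rewrite !mxE addrC andbC; congr (_ + _); rewrite andbC. Qed.

Lemma edge_ge0 (R : numDomainType) (n : nat) (a b p q : 'I_n) :
  0 <= edge R a b p q.
Proof. by rewrite mxE addr_ge0. Qed.

Lemma edge_le2 (R : numDomainType) (n : nat) (a b p q : 'I_n) :
  edge R a b p q <= 2.
Proof. by rewrite mxE lerD // lern1 leq_b1. Qed.

Lemma edge_diag (R : pzSemiRingType) (n : nat) (a b p : 'I_n) :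
  a != b -> edge R a b p p = 0.
Proof.
move=> ab; rewrite mxE; have [->|_] := eqVneq p a; last by rewrite andbF addr0.
by rewrite (negbTE ab) /= addr0.
Qed.

(* The entries at the ['C(n, 2)] positions above the diagonal outside the rows
   [0] and [1] can be perturbed independently, using the alternating 4-cycles
   [a b 1 0]; powers of a suitable small [s] avoid every lower-dimensional
   span of generators. *)
Lemma generic_shift (R : realFieldType) (n m l : nat)
    (v : 'I_m -> 'M[nat]_n.+2) :
  exists r, exists w : 'M[R]_n.+2, [/\ regmx r w, r <= 2 &
    forall X, symmx n.+2 l X -> forall c, greedy v c (natmx R X + w) ->
      ('C(n, 2) <= #|finset (fun i => 0 < c i)%R|)%N].
Proof.
pose E := finset (fun e : 'I_n * 'I_n => e.1 < e.2)%N; pose D := #|E|.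
have DE : D = 'C(n, 2) by rewrite /D card_ltn_pairs.
pose emb (i : 'I_n) : 'I_n.+2 := rshift 2 i.
pose o0 : 'I_n.+2 := ord0; pose o1 : 'I_n.+2 := lift ord0 ord0.
have emb0 i : (emb i == o0) = false by [].
have emb1 i : (emb i == o1) = false by [].
have embI i j : (emb i == emb j) = (i == j) by rewrite -!(inj_eq val_inj) /= eqn_add2l.
pose a (k : 'I_D) := emb (enum_val k).1; pose b (k : 'I_D) := emb (enum_val k).2.
pose u k := cycle4 R (a k) (b k) o1 o0.
have ab k : a k != b k.
  rewrite embI; have := enum_valP k; rewrite inE.
  by apply: contraTneq => ->; rewrite ltnn.
have uE k p q : u k p q = edge R (a k) (b k) p q - edge R (b k) o1 p q +
    edge R o1 o0 p q - edge R o0 (a k) p q by rewrite !mxE.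
have uab j k : u k (a j) (b j) = (k == j)%:R.
  rewrite uE /edge !mxE ![_ == o0]emb0 ![_ == o1]emb1 !andbF !add0r !subr0 !addr0.
  rewrite !embI.
  have -> : ((enum_val j).1 == (enum_val k).2) && ((enum_val j).2 == (enum_val k).1) = false.
    apply/negP => /andP[/eqP e1 /eqP e2].
    have := enum_valP j; have := enum_valP k; rewrite !inE e1 e2 => lt1.
    by move/(ltn_trans lt1); rewrite ltnn.
  rewrite addr0; congr (nat_of_bool _)%:R.
  apply/andP/eqP => [[/eqP e1 /eqP e2]|->//]; apply: enum_val_inj.
  by rewrite [LHS]surjective_pairing [RHS]surjective_pairing e1 e2.
(* The constant off-diagonal value [d] keeps the row sum below one. Entries of [u k] are at least -4
   and there are [D] cycles, so for [s <= s0] the perturbation lowers no entry by more than [d]. *)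
pose d : R := n.+2%:R^-1.
pose w s : 'M[R]_n.+2 :=
  \matrix_(p, q) (d * (p != q)%:R + \sum_(k < D) s ^+ k.+1 * u k p q).
pose s0 : R := (4 * D.+1%:R * n.+2%:R)^-1.
have s0P : 0 < s0 by rewrite invr_gt0 !mulr_gt0.
have wreg s : 0 < s -> s <= s0 -> regmx (d * n.+1%:R) (w s).
  move=> sP ss0; split=> [p q|p q|p|p].
  - rewrite mxE; have [->|pq] := eqVneq p q.
      rewrite mulr0 add0r sumr_ge0 // => k _.
      by rewrite uE !edge_diag // subrr addr0 subrr mulr0.
    have s1 : s <= 1.
      apply: le_trans ss0 _; rewrite invf_le1 ?mulr_gt0 //.
      by rewrite -!natrM ler1n !muln_gt0.
    have : \sum_(k < D) - (s * 4) <= \sum_(k < D) s ^+ k.+1 * u k p q.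
      apply: ler_sum => k _; rewrite lerNl -mulrN.
      apply: (@le_trans _ _ (s ^+ k.+1 * 4)).
        rewrite ler_wpM2l ?exprn_ge0 ?(ltW sP) // uE.
        have := edge_ge0 R (a k) (b k) p q; have := edge_ge0 R o1 o0 p q.
        by have := edge_le2 R (b k) o1 p q; have := edge_le2 R o0 (a k) p q; lra.
      rewrite ler_wpM2r // exprS -[leRHS]mulr1 ler_wpM2l ?(ltW sP) //.
      by rewrite exprn_ile1 // ltW.
    rewrite sumr_const card_ord mulr1 => sumu.
    suff : s * 4 *+ D <= d by move: sumu; rewrite mulNrn; lra.
    apply: (@le_trans _ _ (s0 * (4 * D.+1%:R))).
      rewrite -mulr_natr -mulrA ler_pM ?(ltW sP) ?mulr_ge0 // ler_wpM2l //.
      by rewrite ler_nat.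
    by rewrite /s0 invfM mulrAC mulVf ?mul1r // mulf_neq0 // pnatr_eq0.
  - rewrite !mxE eq_sym; congr (_ + _); apply: eq_bigr => k _.
    by rewrite !uE ![edge _ _ _ p q]edge_sym.
  - rewrite mxE eqxx mulr0 add0r big1 // => k _.
    by rewrite uE !edge_diag // subrr addr0 subrr mulr0.
  - under eq_bigr do rewrite mxE.
    rewrite big_split exchange_big /= [X in _ + X]big1 ?addr0 => [|k _].
      rewrite -mulr_sumr; congr (_ * _).
      rewrite (bigD1 p) //= eqxx add0r (eq_bigr (fun=> 1)) => [|q].
        by rewrite sumr_const cardC1 card_ord.
      by rewrite eq_sym => ->.
    by rewrite -mulr_sumr cycle4_sum mulr0.
(* One polynomial for each matrix and each possible support. There are finitely many, so a single
   [s] avoids the roots of their product; supports of size at least [D] get the harmless factor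
   1. *)
have /choice[Q QP] : forall XS : 'M[nat]_n.+2 * {set 'I_m}, exists Q : {poly R},
    Q != 0 /\ ((#|XS.2| < D)%N -> forall s c,
      (forall k : 'I_D, ((XS.1 (a k) (b k))%:R + d) + s ^+ k.+1 =
         \sum_(i in XS.2) c i * (v i (a k) (b k))%:R) -> root Q s).
  move=> [X S] /=; case: (ltnP #|S| D) => [SD|_].
    have [Q Q0 Qr] := span_root (fun k => (X (a k) (b k))%:R + d)
      (fun i k => (v i (a k) (b k))%:R) SD.
    by exists Q; split=> // _ s c /Qr.
  by exists 1; rewrite oner_neq0.
pose P := \prod_(X <- fset_set (symmx n.+2 l)) \prod_(S : {set 'I_m}) Q (X, S).
have P0 : P != 0.
  rewrite prodf_seq_neq0; apply/allP => X _ /=; apply/prodf_neq0 => S _.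
  by have [] := QP (X, S).
have [s [sP ss0 Ps]] := avoid_root P0 s0P.
exists (d * n.+1%:R), (w s); split; first exact: wreg.
  rewrite mulrC ler_pdivrMr // -natrM ler_nat; lia.
move=> X Xl c [c0 _ cX]; rewrite -DE leqNgt; apply/negP => SD.
pose S := finset (fun i => 0 < c i)%R.
have [_ /(_ SD s c) root_s] := QP (X, S).
move/negP: Ps; apply; rewrite /P (big_rem X) /=; last exact/in_symmx.
rewrite rootM; apply/orP; left.
rewrite (bigD1 S) //= rootM root_s // => k; have := cX (a k) (b k).
rewrite !mxE ab mulr1 (bigD1 k) //= uab eqxx mulr1 big1 ?addr0 => [|j jk].
  rewrite -addrA => ->; rewrite [RHS]big_mkcond; apply: eq_bigr => i _.
  rewrite inE; case: ifP => // /negbT; rewrite -leNgt => ci.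
  by have -> : c i = 0; rewrite ?mul0r //; apply/eqP; rewrite eq_le ci c0.
by rewrite uab (negbTE jk) mulr0.
Qed.

Lemma natmx_addIr (n : nat) (Y : 'M[nat]_n) : injective (fun X => X + Y).
Proof.
move=> X X' /matrixP XY; apply/matrixP => p q.
by have := XY p q; rewrite !mxE => /addIn.
Qed.

Lemma card_natmx_shift (n : nat) (Y : 'M[nat]_n) (A : {fset 'M[nat]_n}) :
  #|` [fset (X + Y)%R | X in A]%fset| = #|` A|.
Proof. by rewrite card_imfset //=; apply: natmx_addIr. Qed.

(* Dually, adding [v i] raises the [i]-th coefficient by at least one whenever it
   is positive; after the shift by [w], at least ['C(n, 2)] of them are. *)
Lemma nsymmx_growth_ge (R : realFieldType) (n l : nat) :
  (l + n * n.-1)%:R * (nsymmx n.+2 l)%:R <=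
    (l + 4)%:R * (nsymmx n.+2 (l + 2))%:R :> R.
Proof.
have [m [v vspan]] := spanning_exists R n.+2; have [vP _] := vspan.
have [r [w [wr r2 wgen]]] := generic_shift R l v.
have r0 : 0 <= r.
  by have [w0 _ _ /(_ ord0) <-] := wr; apply: sumr_ge0.
have /choice[c cP] : forall X : 'M[nat]_n.+2, exists c : 'I_m -> R,
    forall k, symmx n.+2 k X -> greedy v c (natmx R X + w).
  move=> X; have [[k Xk]|nX] := pselect (exists k, symmx n.+2 k X).
    have [c cX] := greedy_exists (ltn0Sn _) vspan
      (regmxD (natmx_regmx R Xk) wr).
    by exists c.
  by exists (fun=> 0) => k Xk; case: nX; exists k.
have c0 X k i : symmx n.+2 k X -> 0 <= c X i by move=> /cP [].
have csum X k : symmx n.+2 k X -> 2 * \sum_i c X i = k%:R + r.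
  move=> Xk; rewrite mulrC.
  exact: (greedy_sum (ltn0Sn _) vP (regmxD (natmx_regmx R Xk) wr) (cP _ _ Xk)).
have cD X i : symmx n.+2 l X -> c X i + (0 < c X i)%R%:R <= c (X + v i) i.
  move=> Xl; have XvD := symmxD Xl (vP i).
  case: ltP => [ci|ci]; last by rewrite addr0 (le_trans ci) // (c0 _ _ _ XvD).
  pose d j := c X j + (j == i)%:R.
  rewrite (@greedy_uniq _ _ _ _ (c (X + v i)) d _ (cP _ _ XvD)).
    by rewrite /d eqxx.
  apply: greedy_sub (cP _ _ Xl) _ _ _ => [j|j|p q].
  - by rewrite addr_ge0 // (c0 _ _ _ Xl).
  - by rewrite /d; case: eqP => [->//|_]; rewrite addr0.
  - have [_ _ /(_ p q)] := cP _ _ Xl; rewrite !mxE natrD => XE.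
    rewrite addrAC XE; under [RHS]eq_bigr do rewrite mulrDl.
    rewrite big_split; congr (_ + _); rewrite (bigD1 i) //= eqxx mul1r big1 ?addr0 //.
    by move=> j /negbTE ->; rewrite mul0r.
have lower X : symmx n.+2 l X ->
    l%:R + r + (n * n.-1)%:R <= 2 * \sum_i c (X + v i) i.
  move=> Xl; rewrite -(csum _ _ Xl).
  have -> : (n * n.-1)%:R = 2 * 'C(n, 2)%:R :> R.
    by rewrite -natrM -(mul_bin_diag n 1) bin1.
  rewrite -mulrDr ler_pM2l //.
  apply: (@le_trans _ _ (\sum_i (c X i + (0 < c X i)%R%:R))); last first.
    by apply: ler_sum => i _; apply: cD.
  rewrite big_split lerD2l /= -natr_sum ler_nat.
  apply: leq_trans (wgen X Xl _ (cP _ _ Xl)) _.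
  rewrite -sum1_card big_mkcond /=; apply: leq_sum => i _.
  by rewrite inE; case: ifP.
have main : (l%:R + r + (n * n.-1)%:R) * (nsymmx n.+2 l)%:R <=
    ((l + 2)%:R + r) * (nsymmx n.+2 (l + 2))%:R :> R.
  have const k (t : R) : t * (nsymmx n.+2 k)%:R =
      \sum_(Y <- fset_set (symmx n.+2 k)) t.
    by rewrite big_const_seq count_predT iter_addr_0 mulr_natr.
  rewrite !const big_seq.
  apply: (@le_trans _ _ (\sum_(X <- fset_set (symmx n.+2 l))
      2 * \sum_i c (X + v i) i)).
    by rewrite [leRHS]big_seq; apply: ler_sum => X /in_symmx /lower.
  have -> : \sum_(Y <- fset_set (symmx n.+2 (l + 2))) ((l + 2)%:R + r) =
      \sum_(Y <- fset_set (symmx n.+2 (l + 2))) 2 * \sum_i c Y i.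
    by rewrite big_seq [RHS]big_seq; apply: eq_bigr => Y /in_symmx /csum.
  rewrite -!mulr_sumr ler_pM2l // exchange_big [leRHS]exchange_big.
  apply: ler_sum => i _ /=.
  apply: (@ler_sum_inj _ _ _ _ _ xpredT (fun X => X + v i) (fun X => c X i)) => //;
  try exact: fset_uniq.
  - by move=> X Y _ _; apply: natmx_addIr.
  - by move=> X /in_symmx Xl _; apply/in_symmx/symmxD.
  - by move=> X /in_symmx /c0.
(* The shift [r] is eliminated by [0 <= r] on the left and [r <= 2] on the right, whence the
   constant 4. *)
have : 0 <= (nsymmx n.+2 l)%:R :> R by [].
have : 0 <= (nsymmx n.+2 (l + 2))%:R :> R by [].
move: main; rewrite !natrD; nra.
Qed.

(** * Monotonicity and positivity of the counts, and reduction of the probability to them *)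

Lemma nsymmx_le (n l l' : nat) (Y : 'M[nat]_n) :
  symmx n l' Y -> (nsymmx n l <= nsymmx n (l + l'))%N.
Proof.
move=> Yl'; rewrite /nsymmx -(card_natmx_shift Y).
apply: fsubset_leq_card; apply/fsubsetP => _ /imfsetP[X /= /in_symmx Xl ->].
by apply/in_symmx; apply: symmxD.
Qed.

(** Joins 2i to 2i + 1. For even [n] this is a perfect matching, used to change the row sum by
    one. *)
Definition matching (n : nat) : 'M[nat]_n :=
  \matrix_(p, q) nat_of_bool ((~~ odd p && (q == p.+1 :> nat)) ||
                               (~~ odd q && (p == q.+1 :> nat))).

Lemma matching_symmx (n : nat) : ~~ odd n -> symmx n 1 (matching n).
Proof.
move=> n_even; split=> [|p|p].
- by apply/matrixP => p q; rewrite !mxE orbC.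
- by rewrite mxE (_ : (p == p.+1 :> nat) = false) ?andbF //; lia.
- have mate_lt : ((if odd p then p.-1 else p.+1) < n)%N.
    by have := ltn_ord p; case: ifP; lia.
  rewrite (bigD1 (Ordinal mate_lt)) //= big1 => [|q]; rewrite mxE /=.
    by case: ifP; case: (val p) => [|k] //=; lia.
  by rewrite -(inj_eq val_inj) /=; case: ifP; lia.
Qed.

(** A matrix of row sum 2 to add exists, because some generator lies in the support of the all-ones
    matrix with zero diagonal. *)
Lemma nsymmx_leD2 (n l : nat) : (1 < n)%N -> (nsymmx n l <= nsymmx n (l + 2))%N.
Proof.
move=> n1; have [m [v [vP vspan]]] := spanning_exists rat n.
have Jreg : regmx (n.-1%:R : rat) (\matrix_(p < n, q < n) (p != q)%:R).
  split=> [p q|p q|p|p]; rewrite ?mxE ?eqxx //; first by rewrite eq_sym.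
  under eq_bigr do rewrite mxE.
  rewrite (bigD1 p) //= eqxx add0r (eq_bigr (fun=> 1)) => [|q].
    by rewrite sumr_const cardC1 card_ord.
  by rewrite eq_sym => ->.
have [|i _] := vspan _ _ Jreg; first by rewrite ltr0n; lia.
exact: nsymmx_le (vP i).
Qed.

Lemma nsymmx_gt0 (n l : nat) : (1 < n)%N -> ~~ odd (n * l) -> (0 < nsymmx n l)%N.
Proof.
move=> n1; rewrite oddM negb_and.
have even_gt0 k : (0 < nsymmx n k.*2)%N.
  elim: k => [|k /leq_trans-> //]; last by rewrite doubleS -addn2 nsymmx_leD2.
  have /in_symmx : symmx n 0 (0 : 'M[nat]_n).
    split=> [|p|p]; rewrite ?linear0 ?mxE // big1 // => q _; by rewrite mxE.
  by rewrite /nsymmx cardfs_gt0 => X0; apply/fset0Pn; exists (0 : 'M[nat]_n).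
case/orP => [n_even|l_even]; last by rewrite -(even_halfK l_even).
have [/even_halfK <- //|l_odd] := boolP (~~ odd l).
rewrite -(odd_double_half l) (negbNE l_odd) addnC.
exact: leq_trans (even_gt0 _) (nsymmx_le _ (matching_symmx n_even)).
Qed.

(** Translation by [J] is the bijection. The conditional is there because truncated subtraction
    would yield [nsymmx n 0], which is 1, where the count is 0. *)
Lemma unif_prob_min (R : realType) (n l k : nat) : (1 < n)%N ->
  unif_prob R (symmx n l) [set X | (k <= min_offdiag X)%N]%classic =
    (if (k * n.-1 <= l)%N then (nsymmx n (l - k * n.-1))%:R else 0) /
      (nsymmx n l)%:R.
Proof.
move=> n1; rewrite /unif_prob -/(nsymmx n l); congr (_ / _).
pose J : 'M[nat]_n := \matrix_(p, q) (k * (p != q))%N.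
have Jl : symmx n (k * n.-1) J.
  split=> [|p|p]; [by apply/matrixP => p q; rewrite !mxE eq_sym|by rewrite mxE eqxx muln0|].
  under eq_bigr do rewrite mxE.
  rewrite -big_distrr (bigD1 p) //= eqxx add0n (eq_bigr (fun=> 1%N)) => [|q].
    by rewrite sum1_card cardC1 card_ord.
  by rewrite eq_sym => ->.
have AE X : X \in fset_set (symmx n l `&` [set X | (k <= min_offdiag X)%N])%classic
    <-> symmx n l X /\ forall p q, (J p q <= X p q)%N.
  rewrite in_fset_set; last exact/finite_setIl/symmx_finite.
  split=> [/set_mem[Xl /min_offdiag_geP kX]|[Xl JX]].
    split=> // p q; rewrite mxE; have [_|pq] := eqVneq p q; first by rewrite muln0.
    by rewrite muln1 kX.
  apply/mem_set; split=> //; apply/(min_offdiag_geP _ _ n1) => p q pq.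
  by have := JX p q; rewrite mxE pq muln1.
case: leqP => kl.
  congr (_ %:R); rewrite -[RHS](card_natmx_shift J).
  congr (#|` _ |); apply/fsetP => X; apply/idP/imfsetP => [/AE[Xl JX]|[Y /in_symmx Yl ->]].
    exists (\matrix_(p, q) (X p q - J p q)%N).
      by apply/in_symmx; apply: symmxB.
    apply/matrixP => p q; rewrite mxE [X in (X + _)%R]mxE.
    exact: (esym (subnK (JX p q))).
  apply/AE; split; last by move=> p q; rewrite [leqRHS]mxE; apply: leq_addl.
  by rewrite -(subnK kl); apply: symmxD.
apply/eqP; rewrite pnatr_eq0 cardfs_eq0; apply/eqP/fsetP => X; rewrite in_fset0.
apply/negP => /AE[[_ _ Xr] JX]; have [_ _ Jr] := Jl.
pose p := Ordinal n1; move: kl; rewrite ltnNge -(Xr p) -(Jr p) => /negP; apply.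
by apply: leq_sum => q _; apply: JX.
Qed.

(** * Bounds on the probability *)

Lemma expR_ge_expn (R : realType) (x : R) (q : nat) :
  0 <= 1 - x -> (1 - x) ^+ q <= expR (- (q%:R * x)).
Proof.
move=> x1; rewrite -mulrN expRM_natl lerXn2r ?nnegrE ?expR_ge0 //.
exact: expR_ge1Dx.
Qed.

(** The inverse of 1 - x is 1 + x / (1 - x), which is at most the exponential of x / (1 - x). *)
Lemma expR_le_expn (R : realType) (x : R) (q : nat) :
  0 <= x < 1 -> expR (- (q%:R * (x / (1 - x)))) <= (1 - x) ^+ q.
Proof.
move=> /andP[x0 x1]; have y0 : 0 < 1 - x by rewrite subr_gt0.
rewrite -mulrN expRM_natl lerXn2r ?nnegrE ?expR_ge0 ?(ltW y0) //.
rewrite expRN -[leRHS]invrK lef_pV2 ?posrE ?expR_gt0 ?invr_gt0 //.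
apply: le_trans (expR_ge1Dx _); rewrite le_eqVlt; apply/orP; left; apply/eqP.
by field; rewrite gt_eqF.
Qed.

(** Put d = n(n-1). Each growth step costs a factor (j + 4) / (j + d) = 1 - (d - 4) / (j + d), which
    increases with j; as every step starts at j <= l - 2, one factor bounds them all. *)
Lemma nsymmx_ratio_le (R : realFieldType) (n q j l : nat) : (4 <= n)%N ->
  (j + 2 * q <= l)%N ->
  (nsymmx n.+2 j)%:R <=
    (1 - (n * n.-1 - 4)%:R / (l + n * n.-1 - 2)%:R) ^+ q *
    (nsymmx n.+2 (j + 2 * q))%:R :> R.
Proof.
move=> n4; have n12 : (12 <= n * n.-1)%N by nia.
set d := (n * n.-1)%N in n12 *.
elim: q j => [|q IHq] j jl; first by rewrite expr0 mul1r muln0 addn0.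
have -> : (j + 2 * q.+1 = j + 2 + 2 * q)%N by lia.
have d0 : 0 < (l + d - 2)%:R :> R by rewrite ltr0n; lia.
have dE : (l + d - 2)%:R = l%:R + d%:R - 2 :> R by rewrite natrB ?natrD //; lia.
have rho0 : 0 <= 1 - (d - 4)%:R / (l + d - 2)%:R :> R.
  by rewrite subr_ge0 ler_pdivrMr // mul1r ler_nat; lia.
rewrite exprS -mulrA; apply: le_trans (ler_wpM2l rho0 (IHq _ _)); last by lia.
have j4 : 0 < (j + d)%:R :> R by rewrite ltr0n; lia.
rewrite -(ler_pM2l j4); apply: le_trans (nsymmx_growth_ge R n j) _.
rewrite mulrA ler_wpM2r //.
rewrite -(ler_pM2r d0) -mulrA mulrBl mul1r divfK ?gt_eqF //.
rewrite dE natrB ?natrD //; last by lia.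
have : j%:R + 2 <= l%:R :> R by rewrite -natrD ler_nat; lia.
have : 12 <= d%:R :> R by rewrite ler_nat.
have : 0 <= j%:R :> R by [].
nra.
Qed.

(** Here [l] bounds the row sums from below: each step costs at least 1 - n^2 / j, which is smallest
    at j = l. *)
Lemma nsymmx_ratio_ge (R : realFieldType) (n q j l : nat) : (0 < n)%N ->
  (n ^ 2 < l)%N -> (l <= j)%N ->
  (1 - (n ^ 2)%:R / l%:R) ^+ q * (nsymmx n (j + 2 * q))%:R <=
    (nsymmx n j)%:R :> R.
Proof.
move=> n0 nl; elim: q j => [|q IHq] j jl; first by rewrite expr0 mul1r muln0 addn0.
have -> : (j + 2 * q.+1 = j + 2 + 2 * q)%N by lia.
have l0 : 0 < l%:R :> R by rewrite ltr0n; lia.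
have j0 : 0 < j%:R :> R by rewrite ltr0n; lia.
have rho0 : 0 <= 1 - (n ^ 2)%:R / l%:R :> R.
  by rewrite subr_ge0 ler_pdivrMr // mul1r ler_nat ltnW.
rewrite exprS -mulrA; apply: le_trans (ler_wpM2l rho0 (IHq _ _)) _; first by lia.
rewrite -(ler_pM2l j0); apply: le_trans (nsymmx_growth_le R j n0).
rewrite mulrA ler_wpM2r // mulrBr mulr1.
have : (n * n.-1)%:R <= (n ^ 2)%:R :> R by rewrite ler_nat; nia.
have : (n ^ 2)%:R <= j%:R * ((n ^ 2)%:R / l%:R) :> R.
  by rewrite mulrCA ler_peMr // ler_pdivlMr // mul1r ler_nat.
rewrite natrD; lra.
Qed.

(** The growth estimates move in steps of two, so [s], which will be [k * n.-1], is rounded to an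
    even number. If [s] is odd then [n.-1] is odd, [n] is even, and a perfect matching makes up the
    difference. *)
Lemma nsymmx_half_le (n l s : nat) : (1 < n)%N -> ~~ odd (n * l) ->
  (n.-1 %| s)%N -> (s <= l)%N ->
  (nsymmx n (l - s) <= nsymmx n (l - 2 * s./2))%N.
Proof.
move=> n1 nl ns sl; have := odd_double_half s; rewrite -mul2n.
case: (boolP (odd s)) => [s_odd|_] /= sE; last by rewrite -{1}sE.
have n_even : ~~ odd n.
  by have := dvdn_odd ns s_odd; lia.
have -> : (l - 2 * s./2 = (l - s) + 1)%N by lia.
exact: nsymmx_le (matching_symmx n_even).
Qed.

Lemma nsymmx_uphalf_le (n l s : nat) : (1 < n)%N -> 
  (n.-1 %| s)%N -> (2 * uphalf s <= l)%N ->
  (nsymmx n (l - 2 * uphalf s) <= nsymmx n (l - s))%N.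
Proof.
move=> n1 ns sl; have := odd_double_half s; rewrite -mul2n; move: sl.
rewrite uphalf_half; case: (boolP (odd s)) => [s_odd|_] /= sl sE.
  have n_even : ~~ odd n by have := dvdn_odd ns s_odd; lia.
  have -> : (l - s = (l - 2 * (1 + s./2)) + 1)%N by lia.
  exact: nsymmx_le (matching_symmx n_even).
by rewrite add0n -{2}sE.
Qed.

(** Iterate the upper ratio bound [s./2] times. With N = n - 2 the exponent involves N(N(N-1) - 4),
    which agrees with n^3 - 7n^2 down to order N^2; this is the origin of the 7. *)
Lemma prob_le (R : realType) (n l k : nat) : (7 <= n)%N -> ~~ odd (n * l) ->
  unif_prob R (symmx n l) [set X | (k <= min_offdiag X)%N]%classic <=
    expR (- (k%:R * (n%:R ^+ 3 - 7 * n%:R ^+ 2) / (2 * (l%:R + n%:R ^+ 2)))).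
Proof.
move=> n7 nl; have n1 : (1 < n)%N by lia.
rewrite unif_prob_min //; set s := (k * n.-1)%N.
case: leqP => [sl|_]; last by rewrite mul0r expR_ge0.
have h0 : 0 < (nsymmx n l)%:R :> R by rewrite ltr0n nsymmx_gt0.
rewrite ler_pdivrMr //.
have : (nsymmx n (l - s))%:R <= (nsymmx n (l - 2 * s./2))%:R :> R.
  by rewrite ler_nat nsymmx_half_le // dvdn_mull.
(* From here on [n] denotes the original size minus two. *)
move/le_trans; apply; case: n => [|[|n]] // in n7 nl n1 s sl h0 *.
have s2l : (2 * s./2 <= l)%N by lia.
have := @nsymmx_ratio_le R n s./2 (l - 2 * s./2) l _ _.
rewrite subnK // => /(_ _ (leqnn l)) => ratio.
apply: le_trans (ratio _) _; first by lia.
rewrite ler_wpM2r //.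
have n12 : (12 <= n * n.-1)%N by nia.
have d0 : 0 < (l + n * n.-1 - 2)%:R :> R by rewrite ltr0n; lia.
apply: le_trans (expR_ge_expn _ _) _.
  by rewrite subr_ge0 ler_pdivrMr // mul1r ler_nat; lia.
rewrite ler_expR lerN2.
have e0 : 0 < 2 * (l%:R + n.+2%:R ^+ 2) :> R.
  by rewrite mulr_gt0 // ltr_wpDl // exprn_gt0.
rewrite ler_pdivrMr // [leRHS](_ : _ = s./2%:R * (n * n.-1 - 4)%:R *
  (2 * (l%:R + n.+2%:R ^+ 2)) / (l + n * n.-1 - 2)%:R); last by ring.
rewrite ler_pdivlMr //.
apply: (@le_trans _ _ (k%:R * (n.+2%:R ^+ 3 - 7 * n.+2%:R ^+ 2) * (l%:R + n.+2%:R ^+ 2))).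
  rewrite ler_wpM2l ?mulr_ge0 //.
    by rewrite subr_ge0 exprS ler_wpM2r ?exprn_ge0 // ler_nat; lia.
  by rewrite -natrX -natrD ler_nat; nia.
rewrite [leRHS]mulrA ler_wpM2r ?addr_ge0 ?exprn_ge0 //.
rewrite [leRHS]mulrAC.
apply: (@le_trans _ _ (k%:R * n%:R * (n * n.-1 - 4)%:R)).
  rewrite -mulrA ler_wpM2l //.
  have [m nE] : exists m, (n = m + 5)%N by exists (n - 5)%N; lia.
  rewrite natrB ?natrM; last by lia.
  have -> : n.-1%:R = m%:R + 4 :> R by rewrite nE -natrD; congr _%:R; lia.
  have -> : n.+2%:R = m%:R + 7 :> R by rewrite nE -natrD; congr _%:R; lia.
  have -> : n%:R = m%:R + 5 :> R by rewrite nE natrD.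
  have : 0 <= m%:R :> R by [].
  nra.
(* Rounding loses at most one, and for positive [k] one has k(n+1) - 1 >= kn. *)
rewrite ler_wpM2r // -!natrM ler_nat /s /=.
by have := odd_double_half (k * n.+1); have := leq_b1 (odd (k * n.+1)); nia.
Qed.

(** At most kn/2 steps are made, all at row sums j >= l - kn, and x / (1 - x) for x = n^2 / j equals
    n^2 / (j - n^2). *)
Lemma prob_ge (R : realType) (n l k : nat) : (1 < n)%N -> ~~ odd (n * l) ->
  (k * n + n ^ 2 < l)%N ->
  expR (- (k%:R * n%:R ^+ 3 / (2 * (l%:R - k%:R * n%:R - n%:R ^+ 2)))) <=
    unif_prob R (symmx n l) [set X | (k <= min_offdiag X)%N]%classic.
Proof.
move=> n1 nl kl; rewrite unif_prob_min //; set s := (k * n.-1)%N.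
have s2 : (2 * uphalf s <= k * n)%N.
  have := odd_double_half s; have := leq_b1 (odd s).
  by rewrite uphalf_half /s; case: (k) => [|k'] /=; nia.
have sl : (s <= l)%N by rewrite /s; nia.
have h0 : 0 < (nsymmx n l)%:R :> R by rewrite ltr0n nsymmx_gt0.
rewrite sl ler_pdivlMr //.
have s2l : (2 * uphalf s <= l)%N by lia.
have : (nsymmx n (l - 2 * uphalf s))%:R <= (nsymmx n (l - s))%:R :> R.
  by rewrite ler_nat nsymmx_uphalf_le // dvdn_mull.
apply: le_trans; set j := (l - 2 * uphalf s)%N.
have nj : (n ^ 2 < j)%N by lia.
have := @nsymmx_ratio_ge R n (uphalf s) j j (ltnW n1) nj (leqnn j).
rewrite subnK // ; apply: le_trans; rewrite ler_wpM2r //.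
have j0 : 0 < j%:R :> R by rewrite ltr0n; lia.
have nj' : (n ^ 2)%:R < j%:R :> R by rewrite ltr_nat.
apply: le_trans (expR_le_expn _ _); last first.
  by rewrite divr_ge0 //= ltr_pdivrMr // mul1r.
rewrite ler_expR lerN2.
have -> : (n ^ 2)%:R / j%:R / (1 - (n ^ 2)%:R / j%:R) = (n ^ 2)%:R / (j%:R - (n ^ 2)%:R) :> R.
  by field; rewrite subr_eq0 -natrX !gt_eqF.
have jl : l%:R - k%:R * n%:R <= j%:R :> R by rewrite lerBlDr -natrM -natrD ler_nat; lia.
have den0 : 0 < l%:R - k%:R * n%:R - n%:R ^+ 2 :> R.
  by rewrite -addrA -opprD subr_gt0 -natrM -natrX -natrD ltr_nat.
have s2R : 2 * (uphalf s)%:R <= k%:R * n%:R :> R by rewrite -!natrM ler_nat.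
rewrite natrX in nj' *.
rewrite mulrA ler_pdivrMr ?subr_gt0 // mulrAC ler_pdivlMr ?mulr_gt0 //.
have -> : (uphalf s)%:R * n%:R ^+ 2 * (2 * (l%:R - k%:R * n%:R - n%:R ^+ 2)) =
  (2 * (uphalf s)%:R) * n%:R ^+ 2 * (l%:R - k%:R * n%:R - n%:R ^+ 2) :> R by ring.
have -> : k%:R * n%:R ^+ 3 = k%:R * n%:R * n%:R ^+ 2 :> R by ring.
rewrite ler_pM ?mulr_ge0 ?exprn_ge0 ?(ltW den0) //.
  by rewrite ler_wpM2r // exprn_ge0.
by rewrite lerB.
Qed.

Lemma ratio_ereal (R : realType) (k l n : nat) :
  (((k * n ^ 3)%N%:R)%:E / (l%:R)%:E)%E =
  (if l == 0%N then (if (k * n == 0)%N then 0%E else +oo%E)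
   else ((k * n ^ 3)%:R / l%:R)%:E) :> \bar R.
Proof.
rewrite inver pnatr_eq0; case: eqP => // _.
have -> : (k * n == 0)%N = (k * n ^ 3 == 0)%N by case: k n => [|k] [|n]; rewrite ?muln0.
case: eqP => [->|/eqP kn]; first by rewrite mul0e.
by rewrite gt0_muley // lte_fin ltr0n lt0n.
Qed.

(** For [14 <= n] the exponent is at least z = kn^3 / (4(l + n^2)), and exp(-z) <= 1/z = 4l / (kn^3)
    + 4 / (kn). *)
Lemma prob_small (R : realType) (n l k : nat) (M : R) : (14 <= n)%N ->
  ~~ odd (n * l) -> 0 < M ->
  (M%:E <= ((k * n ^ 3)%N%:R)%:E / (l%:R)%:E)%E ->
  unif_prob R (symmx n l) [set X | (k <= min_offdiag X)%N]%classic <=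
    4 / M + 4 / n%:R.
Proof.
move=> n14 nl M0; rewrite ratio_ereal => Ma.
have [k0 Ml] : (0 < k)%N /\ M * l%:R <= (k * n ^ 3)%:R.
  move: Ma; case: (posnP l) => [->|l0].
    case: eqP => [_|kn _]; first by rewrite lee_fin leNgt M0.
    by rewrite mulr0; split=> //; rewrite lt0n; apply/eqP => k0; rewrite k0 in kn.
  rewrite lee_fin ler_pdivlMr ?ltr0n // => Ml; split=> //.
  rewrite lt0n; apply: contraTneq Ml => ->.
  by rewrite mul0n -ltNge mulr_gt0 // ltr0n.
have n0 : 0 < n%:R :> R by rewrite ltr0n; lia.
have kR : 1 <= k%:R :> R by rewrite ler1n.
have nR : 14 <= n%:R :> R by rewrite ler_nat.
have l0 : 0 <= l%:R :> R by [].
apply: le_trans (prob_le R k (leq_trans _ n14) nl) _ => //.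
set y := (X in expR (- X)); rewrite natrM natrX in Ml.
have e0 : 0 < l%:R + n%:R ^+ 2 :> R by rewrite ltr_wpDl // exprn_gt0.
pose z : R := k%:R * n%:R ^+ 3 / (4 * (l%:R + n%:R ^+ 2)).
have z0 : 0 < z by rewrite divr_gt0 ?mulr_gt0 ?exprn_gt0 // (lt_le_trans ltr01).
have zy : z <= y.
  rewrite /z /y ler_pdivrMr ?mulr_gt0 // mulrAC ler_pdivlMr ?mulr_gt0 //.
  rewrite -subr_ge0.
  have -> : k%:R * (n%:R ^+ 3 - 7 * n%:R ^+ 2) * (4 * (l%:R + n%:R ^+ 2)) -
    k%:R * n%:R ^+ 3 * (2 * (l%:R + n%:R ^+ 2)) =
    2 * (k%:R * n%:R ^+ 2 * (l%:R + n%:R ^+ 2)) * (n%:R - 14) :> R by ring.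
  by rewrite mulr_ge0 ?subr_ge0 // !mulr_ge0 ?exprn_ge0 // ltW.
apply: (@le_trans _ _ z^-1).
  rewrite expRN lef_pV2 ?posrE ?expR_gt0 //.
  by apply: le_trans (expR_ge1Dx _); lra.
have kn0 : 0 < k%:R * n%:R ^+ 3 :> R by rewrite mulr_gt0 ?exprn_gt0 // (lt_le_trans ltr01).
rewrite /z invf_div ler_pdivrMr //.
have -> : (4 / M + 4 / n%:R) * (k%:R * n%:R ^+ 3) =
    4 * (k%:R * n%:R ^+ 3 / M + k%:R * n%:R ^+ 2) by field; rewrite !gt_eqF.
rewrite ler_pM2l // lerD //; first by rewrite ler_pdivlMr // mulrC.
by rewrite ler_peMl // exprn_ge0 // ltW.
Qed.

(** Turns an additive error in the exponent into a relative error, through 1 - d <= exp(-d) and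
    exp(d) <= 1 / (1 - d) <= 1 + 2d. *)
Lemma norm_expRB_le (R : realType) (P x d : R) : 0 <= d -> 2 * d <= 1 ->
  expR (- (x + d)) <= P -> P <= expR (- (x - d)) ->
  `|P - expR (- x)| <= 2 * d * expR (- x).
Proof.
move=> d0 d1; rewrite !opprD opprK !expRD => lo up.
have g0 := expR_gt0 (- x).
have ed : 1 - d <= expR (- d) by apply: expR_ge1Dx.
have ed' : expR d <= 1 + 2 * d.
  have -> : expR d = (expR (- d))^-1 by rewrite expRN invrK.
  rewrite invf_ple ?posrE ?expR_gt0 //; last by lra.
  apply: le_trans ed; rewrite -[leLHS]mul1r ler_pdivrMr; last by lra.
  nra.
rewrite ler_norml lerBlDr lerBrDr; apply/andP; split.
  by apply: le_trans lo; nra.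
by apply: le_trans up _; nra.
Qed.

(** Since k >= 1 and kn^3 <= Cl, the quantities n^2, kn and kn^2 are all at most t = Cl / n. The
    corrections in both exponents are thus of relative order C/n; the constant 10 leaves some
    room. *)
Lemma prob_bounded (R : realType) (n l k : nat) (C : R) : 1 <= C ->
  7 <= n%:R :> R -> 4 * C < n%:R -> ~~ odd (n * l) -> (0 < k)%N -> (0 < l)%N ->
  k%:R * n%:R ^+ 3 / l%:R <= C ->
  let P : R := unif_prob R (symmx n l) [set X | (k <= min_offdiag X)%N]%classic in
  let x : R := k%:R * n%:R ^+ 3 / l%:R / 2 in
  let d : R := 10 * C ^+ 2 / n%:R in
  expR (- (x + d)) <= P /\ P <= expR (- (x - d)).
Proof.
move=> C1 n7 nC nl k0 l0; set a := k%:R * n%:R ^+ 3 / l%:R => aC P x d.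
have n7' : (7 <= n)%N by rewrite -(ler_nat R).
have nP : 0 < n%:R :> R by lra.
have lP : 0 < l%:R :> R by rewrite ltr0n.
have kP : 1 <= k%:R :> R by rewrite ler1n.
have a0 : 0 <= a by rewrite divr_ge0 ?mulr_ge0 ?exprn_ge0 // ltW.
have kna : k%:R * n%:R ^+ 3 = a * l%:R by rewrite divfK ?gt_eqF.
pose t : R := C * l%:R / n%:R.
have tE : t * n%:R = C * l%:R by rewrite divfK ?gt_eqF.
have t0 : 0 <= t by rewrite divr_ge0 ?mulr_ge0 ?(ltW lP) ?(ltW nP) //; lra.
have n2t : k%:R * n%:R ^+ 2 <= t.
  rewrite -(ler_pM2r nP) tE (_ : _ * _ = k%:R * n%:R ^+ 3); last by ring.
  by rewrite kna ler_pM2r.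
have n2 : n%:R ^+ 2 <= t by apply: le_trans n2t; rewrite ler_peMl // exprn_ge0 // ltW.
have kn : k%:R * n%:R <= t.
  by apply: le_trans n2t; rewrite ler_wpM2l // ?expr2 ?ler_peMl //; lra.
have tl : 4 * t <= l%:R.
  by rewrite -(ler_pM2r nP) -mulrA tE mulrA mulrC ler_pM2l // ltW.
have dl : d * l%:R = 10 * (C * t) by rewrite /d /t; field; rewrite gt_eqF.
have d0 : 0 <= d by rewrite /d divr_ge0 ?mulr_ge0 ?exprn_ge0 //; lra.
have tC : t <= C * t by rewrite ler_peMl.
split.
  have := @prob_ge R n l k _ nl _; rewrite -/P => lo.
  apply: le_trans (lo _ _); last 2 first.
  - exact: leq_trans n7'.
  - by rewrite -(ltr_nat R) natrD natrM natrX; lra.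
  rewrite ler_expR lerN2 kna.
  set e := l%:R - _ - _; have e2 : l%:R <= 2 * e by rewrite /e; lra.
  have eP : 0 < e by lra.
  rewrite ler_pdivrMr ?mulr_gt0 // /x.
  have kn0 : 0 <= k%:R * n%:R + n%:R ^+ 2 :> R.
    by rewrite addr_ge0 ?mulr_ge0 ?exprn_ge0.
  have ale : a * (l%:R - e) <= C * (2 * t) by rewrite ler_pM // /e; lra.
  have : d * l%:R <= d * (2 * e) by rewrite ler_wpM2l.
  move: ale; rewrite mulrBr mulrDl; lra.
have := @prob_le R n l k n7' nl; rewrite -/P => up.
apply: le_trans up _; rewrite ler_expR lerN2.
have e0 : 0 < l%:R + n%:R ^+ 2 :> R by rewrite ltr_wpDl ?exprn_gt0 ?ltW.
rewrite ler_pdivlMr ?mulr_gt0 // /x.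
have -> : (a / 2 - d) * (2 * (l%:R + n%:R ^+ 2)) =
  a * l%:R + a * n%:R ^+ 2 - 2 * d * (l%:R + n%:R ^+ 2) by field.
have -> : k%:R * (n%:R ^+ 3 - 7 * n%:R ^+ 2) =
  a * l%:R - 7 * (k%:R * n%:R ^+ 2) by rewrite -kna; ring.
have an : a * n%:R ^+ 2 <= C * t by rewrite ler_pM ?exprn_ge0 // ltW.
have dn : 0 <= d * n%:R ^+ 2 by rewrite mulr_ge0 // exprn_ge0 // ltW.
rewrite mulrDr -!(mulrA 2) dl; lra.
Qed.

(** * The two limit statements *)

Local Open Scope classical_set_scope.

Theorem theorem8p1 (R : realType) (k l : nat -> nat)
  (hnl : forall n : nat, ~~ odd (n * l n)) :
  (* Division in [\bar R]: [x / 0 = +oo] for [x > 0], and [0 / 0 = 0]. *)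
  let a (n : nat) : \bar R := (((k n * n ^ 3)%N%:R)%:E / ((l n)%:R)%:E)%E in
  let P (n : nat) : R :=
    unif_prob R (symmx n (l n)) [set X | (k n <= min_offdiag X)%N] in
  (a n @[n --> \oo] --> +oo%E -> P n @[n --> \oo] --> (0 : R)) /\
  ((exists C : R, \forall n \near \oo, (`|a n| <= C%:E)%E) ->
   P ~_\oo (fun n => expR (- (fine (a n) / 2)))).
Proof.
move=> a P; split=> [/cvgeyPge a_oo|[C0 aC0]].
  apply/cvgrPdist_le => e e0; near=> n.
  rewrite sub0r normrN ger0_norm; last by rewrite divr_ge0.
  (* With M = 8/e, both [4 / M] and, for n >= 8/e, [4 / n] are at most e/2. *)
  have M0 : 0 < 8 / e by rewrite divr_gt0.
  have n14 : (14 <= n)%N by near: n; exists 14%N.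
  have Ma : ((8 / e)%:E <= a n)%E by near: n; apply: a_oo.
  apply: le_trans (prob_small n14 (hnl n) M0 Ma) _.
  have ne : 8 / e <= n%:R by near: n; apply: nbhs_infty_ger.
  have nP : 0 < n%:R :> R by rewrite ltr0n; lia.
  have : 4 / n%:R <= e / 2.
    by move: ne; rewrite !ler_pdivrMr //; lra.
  by rewrite invf_div mulrCA mulrA; lra.
pose C := Num.max C0 1; have C1 : 1 <= C by rewrite le_max lexx orbT.
pose K : R := 10 * C ^+ 2.
have K0 : 0 < K by rewrite mulr_gt0 // exprn_gt0 // (lt_le_trans ltr01).
apply/eqaddoP => e e0; near=> n.
have n7 : 7 <= n%:R :> R by near: n; apply: nbhs_infty_ger.
have nC : 4 * C + 1 <= n%:R by near: n; apply: nbhs_infty_ger.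
(* For d = K/n, this and the next bound give 2d <= 1 and 2d <= e. *)
have nK : 2 * K <= n%:R by near: n; apply: nbhs_infty_ger.
have ne : 2 * K / e <= n%:R by near: n; apply: nbhs_infty_ger.
have aC : (`|a n| <= C%:E)%E.
  apply: (@le_trans _ _ C0%:E); first by near: n.
  by rewrite lee_fin le_max lexx.
have nP : 0 < n%:R :> R by lra.
have n2 : (1 < n)%N by rewrite -(ltr_nat R); lra.
rewrite /= !fctE [X in _ <= _ * X]ger0_norm ?expR_ge0 //.
(* For k = 0 nothing forces [l] to be large, but then the probability is exactly 1 and a = 0. *)
have [k0|k0] := posnP (k n).
  have -> : P n = 1.
    rewrite /P unif_prob_min // k0 mul0n leq0n subn0 divff //.
    by rewrite pnatr_eq0 -lt0n nsymmx_gt0.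
  have -> : a n = 0%E by rewrite /a k0 mul0n mul0e.
  by rewrite mul0r oppr0 expR0 subrr normr0 mulr1 ltW.
(* With [k n] positive, [l n = 0] would make [a n] infinite, against its bound. *)
move: aC; rewrite /a ratio_ereal; case: eqP => [l0|/eqP l0].
  by case: eqP; [lia|].
rewrite abse_EFin lee_fin ger0_norm ?divr_ge0 // natrM natrX /= => aC.
have l0' : (0 < l n)%N by rewrite lt0n.
have [lo up] := prob_bounded C1 n7 (ltac:(lra) : 4 * C < n%:R) (hnl n) k0 l0' aC.
apply: le_trans (norm_expRB_le _ _ lo up) _.
- by rewrite divr_ge0 // ltW.
- by rewrite -/K mulrA ler_pdivrMr // mul1r.
- rewrite ler_wpM2r ?expR_ge0 // -/K mulrA; move: ne.
  by rewrite !ler_pdivrMr //; lra.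
Unshelve. all: by end_near.
Qed.
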